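(* Let $E$ be a real Banach space, $a<b$ real numbers, $A\colon D(A)\subset E\to E$ a linear, not necessarily bounded, operator which generates a $C_0$-semigroup $S\colon[0,\infty)\to\mathcal{L}(E)$, and $f\colon[a,b]\times E\to E$ continuous. Let $K\subset E$ be nonempty, open and bounded, and assume there exists a locally Lipschitzian function $V\colon E\to\mathbb{R}$ which is a bounding function, with respect to $K$, for the equation $x'(t)=Ax(t)+f(t,x(t))$, $t\in[a,b]$. Suppose there is $\delta\in(0,\infty)$ such that $$S(\tau)\overline K\subseteq\overline K\quad\text{for all }\tau\in[0,\delta].$$ If $x\colon[a,b]\to E$ is a mild solution of $x'(t)=Ax(t)+f(t,x(t))$ with $x(t)\in\overline K$ for all $t\in[a,b]$, then $x(t)\in K$ for all $t\in(a,b]$.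
   Context: Mild solution: a function $x\in C([a,b],E)$ is a mild solution of $x'=Ax+f(t,x)$ if $x(t)=S(t-a)x(a)+\int_a^tS(t-s)f(s,x(s))\,ds$ for $t\in[a,b]$. Bounding function: for $K\subset E$ nonempty, open and bounded, a function $V\colon E\to\mathbb{R}$ is a bounding function (with respect to $K$) for the equation $x'=Ax+f(t,x)$ if (V1) $V=0$ on $\partial K$ and $V\le0$ on $K$; (V2) $\liminf_{h\to0^-}\frac{V(x+hf(t,x))}{h}<0$ for all $t\in(a,b]$ and $x\in\partial K$. *)

(* Defs.v *)
From Stdlib Require Import Reals.
From Coquelicot Require Import Coquelicot.
Open Scope R_scope.

Definition closure {T : UniformSpace} (D : T -> Prop) (x : T) : Prop :=
  forall P : T -> Prop, locally x P -> exists y, P y /\ D y.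

Definition boundary {T : UniformSpace} (D : T -> Prop) (x : T) : Prop :=
  closure D x /\ closure (fun y => ~ D y) x.

Definition norm_bounded {E : NormedModule R_AbsRing} (D : E -> Prop) : Prop :=
  exists M : R, forall x, D x -> norm x <= M.

Definition locally_Lipschitz {E : NormedModule R_AbsRing} (V : E -> R) : Prop :=
  forall x, exists (L : R) (U : E -> Prop), locally x U /\
    forall y z, U y -> U z -> Rabs (V y - V z) <= L * norm (minus y z).

(* sup over P in F of inf over P of g, in the extended reals *)
Definition LimInf_filter {T : Type} (F : (T -> Prop) -> Prop) (g : T -> R) : Rbar :=
  Rbar_lub (fun m => exists P, F P /\
    m = Glb_Rbar (fun y => exists u, P u /\ y = g u)).

(* A partially defined operator is a domain [D] together with a total function
   [A] whose values outside [D] are irrelevant. *)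
Definition linear_operator {E : NormedModule R_AbsRing}
    (D : E -> Prop) (A : E -> E) : Prop :=
  D zero /\
  (forall x y, D x -> D y -> D (plus x y) /\ A (plus x y) = plus (A x) (A y)) /\
  (forall (k : R) x, D x -> D (scal k x) /\ A (scal k x) = scal k (A x)).

(* Only the values [S t] with [0 <= t] are constrained; [is_linear] includes
   boundedness. *)
Definition C0_semigroup {E : NormedModule R_AbsRing} (S : R -> E -> E) : Prop :=
  (forall t, 0 <= t -> is_linear (S t)) /\
  (forall x, S 0 x = x) /\
  (forall s t x, 0 <= s -> 0 <= t -> S (s + t) x = S s (S t x)) /\
  (forall x, filterlim (fun t => S t x) (at_right 0) (locally x)).

(* [D] is exactly the set of [x] at which the difference quotient converges,
   and [A x] is the limit. *)
Definition generates {E : NormedModule R_AbsRing}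
    (D : E -> Prop) (A : E -> E) (S : R -> E -> E) : Prop :=
  forall x y, (D x /\ A x = y) <->
    filterlim (fun h => scal (/ h) (minus (S h x) x)) (at_right 0) (locally y).

(* The operator [A] enters only through the semigroup [S] it generates. *)
Definition mild_solution {E : CompleteNormedModule R_AbsRing}
    (S : R -> E -> E) (f : R -> E -> E) (a b : R) (x : R -> E) : Prop :=
  continuous_on (fun t => a <= t <= b) x /\
  forall t, a <= t <= b ->
    x t = plus (S (t - a) (x a)) (RInt (fun s => S (t - s) (f s (x s))) a t).

(* [A] does not occur in the conditions on a bounding function. *)
Definition bounding_function {E : NormedModule R_AbsRing}
    (f : R -> E -> E) (a b : R) (K : E -> Prop) (V : E -> R) : Prop :=
  (forall x, boundary K x -> V x = 0) /\
  (forall x, K x -> V x <= 0) /\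
  (forall t x, a < t <= b -> boundary K x ->
     Rbar_lt (LimInf_filter (at_left 0) (fun h => V (plus x (scal h (f t x))) / h))
             (Finite 0)).

(* Main.v *)
Require Import Defs.
From Stdlib Require Import Reals Lra Psatz Classical.
From Coquelicot Require Import Coquelicot.
Open Scope R_scope.

(** Suppose that a mild solution with values in the closure of [K] reaches the
    boundary of [K] at a time [t > a].  For small [h < 0], restarting the
    variation-of-constants formula at time [t + h] gives

      [S (-h) (x (t + h)) = x t - int_{t+h}^t S (t - s) (f s (x s)) ds
                          = x t + h f(t, x t) + o(h)]

    ([mild_solution_backward_expansion]).  The left-hand side belongs to the
    closure of [K], because the semigroup leaves that set invariant for short
    times, so [V] is nonpositive there.  As [V] is Lipschitz near [x t],
    [V (x t + h f(t, x t)) <= o(|h|)].  Dividing by the negative number [h]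
    turns this into a lower bound [- o(1)] for the quotient in the transversality
    condition on [V]; its lower limit is therefore nonnegative
    ([LimInf_quotient_nonneg]), which contradicts that condition.

    The expansion needs the integrand [S (t - s) (f s (x s))] to be continuous
    in [s], hence a bound on the operator norms of [S tau] over compact time
    intervals.  For an arbitrary semigroup this is the uniform boundedness
    principle.  Here the geometry gives it directly: for short times [S tau]
    maps a ball contained in [K] into the bounded closure of [K], and a linear
    map that is bounded on a ball has its operator norm controlled by the
    radius of the ball and the bound ([linear_bound_of_ball]).  The semigroup
    law propagates the estimate to longer times ([semigroup_bound_extend]). *)

(** * Normed modules and linear maps *)

Lemma norm_minus_sym {E : NormedModule R_AbsRing} (x y : E) :
  norm (minus x y) = norm (minus y x).
Proof. now rewrite <- norm_opp, opp_minus. Qed.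

Lemma norm_minus_diag {E : NormedModule R_AbsRing} (x : E) :
  norm (minus x x) = 0.
Proof.
  etransitivity; [exact (f_equal norm (minus_eq_zero (x : E)))|apply norm_zero].
Qed.

Lemma norm_scal_Rabs {E : NormedModule R_AbsRing} (c : R) (x : E) :
  norm (scal c x) <= Rabs c * norm x.
Proof. exact (@norm_scal R_AbsRing E c x). Qed.

Lemma minus_plus_l {E : NormedModule R_AbsRing} (x y : E) : minus (plus x y) x = y.
Proof.
  unfold minus.
  rewrite (plus_comm x y), <- plus_assoc.
  etransitivity; [exact (f_equal _ (plus_opp_r x))|apply plus_zero_r].
Qed.

Lemma plus_minus_r {E : NormedModule R_AbsRing} (x y : E) : plus x (minus y x) = y.
Proof.
  unfold minus.
  rewrite (plus_comm y), plus_assoc.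
  etransitivity; [exact (f_equal (fun z => plus z y) (plus_opp_r x))|].
  apply plus_zero_l.
Qed.

Lemma minus_minus_scal_opp {E : NormedModule R_AbsRing} (u v w : E) (h : R) :
  minus (minus u w) (scal (- h) v) = minus (plus u (scal h v)) w.
Proof.
  assert (ho : opp (scal (- h) v) = scal h v).
  { etransitivity; [symmetry; exact (@scal_opp_l R_Ring E (- h) v)|].
    exact (f_equal (fun c : R => scal c v) (Ropp_involutive h)). }
  unfold minus.
  etransitivity; [exact (f_equal (plus (plus u (opp w))) ho)|].
  rewrite <- !plus_assoc. f_equal. apply plus_comm.
Qed.

(** A ball about [k] is translated to the origin by subtracting [l k], itself
    bounded by [M]; this doubles the bound.  Rescaling [y] to norm [r / 2], to
    stay strictly inside the ball, accounts for the other factor 2. *)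
Lemma linear_bound_of_ball {E F : NormedModule R_AbsRing} (l : E -> F)
    (k : E) (r M : R) :
  is_linear l -> 0 < r ->
  (forall y, norm (minus y k) < r -> norm (l y) <= M) ->
  forall y, norm (l y) <= 4 * M / r * norm y.
Proof.
  intros hl hr hM y.
  assert (hM0 : norm (l k) <= M).
  { apply hM. rewrite norm_minus_diag. exact hr. }
  assert (hk := norm_ge_0 (l k)).
  assert (hN := norm_ge_0 y).
  destruct (Req_dec (norm y) 0) as [h0|h0].
  - destruct (linear_norm l hl) as [m [_ hm]].
    specialize (hm y). rewrite h0 in *. lra.
  - set (c := r / (2 * norm y)).
    assert (hc : 0 < c) by (unfold c; apply Rdiv_lt_0_compat; lra).
    assert (h1 : norm (l (plus k (scal c y))) <= M).
    { apply hM. rewrite minus_plus_l.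
      apply Rle_lt_trans with (1 := norm_scal_Rabs c y).
      rewrite Rabs_pos_eq by lra.
      unfold c. replace (r / (2 * norm y) * norm y) with (r / 2) by (now field).
      lra. }
    assert (h2 : norm (scal c (l y)) <= 2 * M).
    { replace (scal c (l y)) with (minus (l (plus k (scal c y))) (l k)).
      - eapply Rle_trans; [apply norm_triangle|]. rewrite norm_opp. lra.
      - rewrite (linear_plus l hl), minus_plus_l. apply (linear_scal l hl). }
    replace (l y) with (scal (/ c) (scal c (l y))).
    2:{ rewrite scal_assoc. change (scal (/ c * c) (l y) = l y).
        rewrite Rinv_l by lra. apply (scal_one (l y)). }
    eapply Rle_trans; [apply norm_scal_Rabs|].
    assert (hic : 0 < / c) by now apply Rinv_0_lt_compat.
    rewrite Rabs_pos_eq by lra.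
    apply Rle_trans with (/ c * (2 * M)).
    + apply Rmult_le_compat_l; lra.
    + unfold c. right. field. lra.
Qed.

Lemma Riemann_sum_linear {E F : NormedModule R_AbsRing} (l : E -> F)
    (g : R -> E) (ptd : SF_seq) :
  is_linear l -> Riemann_sum (fun s => l (g s)) ptd = l (Riemann_sum g ptd).
Proof.
  intros hl.
  induction ptd as [x0|h s IH] using SF_cons_ind.
  - unfold Riemann_sum; simpl. symmetry.
    exact (linear_zero l hl).
  - rewrite !Riemann_sum_cons, IH, (linear_plus l hl). f_equal.
    symmetry. apply (linear_scal l hl).
Qed.

(** A bounded linear map commutes with Riemann sums exactly and with their
    limit by continuity. *)
Lemma is_RInt_linear {E F : NormedModule R_AbsRing} (l : E -> F)
    (g : R -> E) (a b : R) (I : E) :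
  is_linear l -> is_RInt g a b I -> is_RInt (fun s => l (g s)) a b (l I).
Proof.
  intros hl hg. unfold is_RInt in *.
  apply filterlim_ext with
    (fun ptd => l (scal (sign (b - a)) (Riemann_sum g ptd))).
  - intros ptd. rewrite (Riemann_sum_linear l g ptd hl).
    apply (linear_scal l hl).
  - eapply filterlim_comp; [exact hg|]. apply (linear_cont l I hl).
Qed.

(** * Extending functions beyond a compact interval *)

(** Integrability criteria ask for two-sided continuity at the endpoints of the
    interval.  Precomposing with the retraction of the line onto [[a, b]] turns
    continuity relative to the interval into continuity everywhere. *)
Definition clamp (a b s : R) : R := Rmax a (Rmin b s).

Lemma clamp_bounds (a b s : R) : a <= b -> a <= clamp a b s <= b.
Proof.
  intros h. unfold clamp, Rmax, Rmin.
  repeat destruct Rle_dec; lra.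
Qed.

Lemma clamp_id (a b s : R) : a <= s <= b -> clamp a b s = s.
Proof.
  intros h. unfold clamp, Rmax, Rmin.
  repeat destruct Rle_dec; lra.
Qed.

Lemma clamp_contract (a b s t : R) :
  a <= b -> Rabs (clamp a b s - clamp a b t) <= Rabs (s - t).
Proof.
  intros h. unfold clamp, Rmax, Rmin.
  repeat destruct Rle_dec; unfold Rabs; repeat destruct Rcase_abs; lra.
Qed.

Lemma continuous_clamp {E : UniformSpace} (a b : R) (g : R -> E) :
  a <= b -> continuous_on (fun s => a <= s <= b) g ->
  forall s, continuous (fun r => g (clamp a b r)) s.
Proof.
  intros hab hg s.
  unfold continuous.
  eapply filterlim_comp; [|exact (hg (clamp a b s) (clamp_bounds a b s hab))].
  intros P [eps hP]. exists eps. intros r hr.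
  apply hP.
  - change (Rabs (clamp a b r - clamp a b s) < eps).
    eapply Rle_lt_trans; [now apply clamp_contract|exact hr].
  - now apply clamp_bounds.
Qed.

Lemma continuous_on_graph {E F : UniformSpace} (a b : R)
    (f : R -> E -> F) (x : R -> E) :
  continuous_on (fun p : R * E => a <= fst p <= b)
    (fun p : R * E => f (fst p) (snd p)) ->
  continuous_on (fun s => a <= s <= b) x ->
  continuous_on (fun s => a <= s <= b) (fun s => f s (x s)).
Proof.
  intros hf hx s hs P hP.
  destruct (hf (s, x s) hs P hP) as [eps heps].
  destruct (proj1 (filterlim_locally x (x s)) (hx s hs) eps) as [d hd].
  assert (hm : 0 < Rmin eps d) by (apply Rmin_pos; apply cond_pos).
  exists (mkposreal _ hm). intros r hr hrab.
  apply (heps (r, x r)); [split; simpl|exact hrab].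
  - eapply ball_le; [|exact hr]. apply Rmin_l.
  - apply hd; [|exact hrab]. eapply ball_le; [|exact hr]. apply Rmin_r.
Qed.

(** * Bounds and joint continuity for semigroups *)

Section Semigroup.
Context {E : NormedModule R_AbsRing} (S : R -> E -> E) (hS : C0_semigroup S).

(** The operators [S tau] map a fixed ball inside [K] into a bounded set
    independent of [tau], which replaces the uniform boundedness principle. *)
Lemma semigroup_bound_of_invariant (K : E -> Prop) (delta : R) :
  (exists x, K x) -> open K -> norm_bounded (closure K) ->
  (forall tau, 0 <= tau <= delta -> forall y, closure K y -> closure K (S tau y)) ->
  exists C, forall tau, 0 <= tau <= delta -> forall y, norm (S tau y) <= C * norm y.
Proof.
  intros [k hk] hKo [M hM] hinv.
  destruct (locally_norm_le_locally k K (hKo k hk)) as [r hr].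
  exists (4 * M / r). intros tau htau.
  apply (linear_bound_of_ball (S tau) k r M).
  - apply hS, htau.
  - apply cond_pos.
  - intros y hy. apply hM, (hinv tau htau).
    intros P hP. exists y. split; [now apply locally_singleton|now apply hr].
Qed.

(** Peeling off steps of length [delta] multiplies the bound by [C] each time,
    and finitely many steps cover [[0, T]]. *)
Lemma semigroup_bound_extend (delta : R) : 0 < delta ->
  (exists C, forall tau, 0 <= tau <= delta -> forall y, norm (S tau y) <= C * norm y) ->
  forall T, exists C, 0 < C /\
    forall tau, 0 <= tau <= T -> forall y, norm (S tau y) <= C * norm y.
Proof.
  intros hd [C0 hC0].
  destruct hS as [_ [_ [hadd _]]].
  (* A constant at least 1 makes its powers increase with the number of steps. *)
  set (C := Rabs C0 + 1).
  assert (hC : 1 <= C) by (unfold C; generalize (Rabs_pos C0); lra).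
  assert (hb : forall tau, 0 <= tau <= delta -> forall y, norm (S tau y) <= C * norm y).
  { intros tau ht y. eapply Rle_trans; [now apply hC0|].
    apply Rmult_le_compat_r; [apply norm_ge_0|].
    unfold C. generalize (Rle_abs C0); lra. }
  assert (hn : forall n tau, 0 <= tau <= INR n * delta ->
             forall y, norm (S tau y) <= C ^ n * C * norm y).
  { induction n as [|n IH]; intros tau ht y.
    - simpl in *. rewrite Rmult_1_l. apply hb. lra.
    - rewrite S_INR in ht.
      assert (hp : 1 <= C ^ n) by now apply pow_R1_Rle.
      destruct (Rle_dec tau delta) as [hle|hgt].
      + eapply Rle_trans; [apply hb; lra|].
        apply Rmult_le_compat_r; [apply norm_ge_0|].
        simpl. nra.
      + replace tau with (delta + (tau - delta)) by ring.
        rewrite hadd by lra.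
        eapply Rle_trans; [apply hb; lra|].
        simpl. rewrite !Rmult_assoc. apply Rmult_le_compat_l; [lra|].
        rewrite <- Rmult_assoc. apply IH. lra. }
  intros T.
  destruct (nfloor_ex (Rmax 0 (T / delta))) as [n [_ h]]; [apply Rmax_l|].
  exists (C ^ (n + 1) * C). split.
  { apply Rmult_lt_0_compat; [apply pow_lt|]; lra. }
  intros tau ht. apply hn.
  assert (h' := Rmax_r 0 (T / delta)).
  rewrite plus_INR. simpl.
  assert (hT : T = T / delta * delta) by (field; lra). nra.
Qed.

(** Factoring [S (min u v)] out of the difference reduces continuity of orbits,
    from either side and at any time, to continuity from the right at time 0. *)
Lemma semigroup_orbit_modulus (T C : R) :
  (forall tau, 0 <= tau <= T -> forall y, norm (S tau y) <= C * norm y) ->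
  forall u v y, 0 <= u <= T -> 0 <= v <= T ->
  norm (minus (S u y) (S v y)) <= C * norm (minus (S (Rabs (u - v)) y) y).
Proof.
  intros hC.
  assert (hlt : forall u v y, 0 <= v -> v <= u -> u <= T ->
    norm (minus (S u y) (S v y)) <= C * norm (minus (S (u - v) y) y)).
  { intros u v y hv hvu hu.
    replace u with (v + (u - v)) at 1 by ring.
    destruct hS as [hlin [_ [hadd _]]].
    rewrite hadd by lra.
    rewrite <- (linear_minus (S v)) by now apply hlin.
    apply hC. lra. }
  intros u v y hu hv.
  destruct (Rle_dec v u).
  - rewrite Rabs_pos_eq by lra. apply hlt; lra.
  - rewrite norm_minus_sym, Rabs_minus_sym, Rabs_pos_eq by lra. apply hlt; lra.
Qed.

(** Strong continuity and a uniform operator bound give joint continuity: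
    [S u g - S u0 g0 = S u (g - g0) + (S u - S u0) g0]. *)
Lemma semigroup_continuous (u : R -> R) (g : R -> E) (T C s : R) : 0 < C ->
  (forall tau, 0 <= tau <= T -> forall y, norm (S tau y) <= C * norm y) ->
  (forall r, 0 <= u r <= T) -> continuous u s -> continuous g s ->
  continuous (fun r => S (u r) (g r)) s.
Proof.
  intros hC0 hC hu hcu hcg.
  apply filterlim_locally_ball_norm. intros eps.
  assert (he : 0 < eps / (2 * C)).
  { apply Rdiv_lt_0_compat; [apply cond_pos|lra]. }
  set (e := mkposreal _ he).
  assert (hg := proj1 (filterlim_locally_ball_norm g (g s)) hcg e).
  destruct hS as [hlin [hid [_ hlim]]].
  destruct (proj1 (filterlim_locally_ball_norm _ (g s)) (hlim (g s)) e) as [d hd].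
  assert (hu' := proj1 (filterlim_locally u (u s)) hcu d).
  generalize (filter_and _ _ hg hu'). apply filter_imp.
  intros r [h1 h2]. unfold ball_norm in *. simpl in h1.
  assert (h3 : norm (minus (S (u r) (g s)) (S (u s) (g s))) < C * e).
  { eapply Rle_lt_trans; [now apply (semigroup_orbit_modulus T C)|].
    apply Rmult_lt_compat_l; [exact hC0|].
    destruct (Req_dec (u r) (u s)) as [heq|hne].
    - rewrite heq, Rminus_diag, Rabs_R0, hid, norm_minus_diag.
      exact he.
    - apply hd.
      + change (Rabs (Rabs (u r - u s) - 0) < d).
        rewrite Rminus_0_r, Rabs_Rabsolu. exact h2.
      + apply Rabs_pos_lt. lra. }
  assert (h4 : norm (minus (S (u r) (g r)) (S (u r) (g s))) < C * e).
  { rewrite <- linear_minus by apply hlin, hu.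
    eapply Rle_lt_trans; [apply hC, hu|].
    now apply Rmult_lt_compat_l. }
  rewrite (minus_trans (S (u r) (g s))).
  eapply Rle_lt_trans; [apply norm_triangle|].
  replace (pos eps) with (C * e + C * e) by (simpl; field; lra).
  lra.
Qed.

End Semigroup.

(** * Restarting a mild solution *)

Section Mild.
Context {E : CompleteNormedModule R_AbsRing} (S : R -> E -> E)
  (hS : C0_semigroup S).

(** The variation-of-constants integrand [S (t - s) (g s)], with the time lag
    and the time clamped so as to be continuous in [s] on the whole line. *)
Definition duhamel_integrand (g : R -> E) (a b t s : R) : E :=
  S (clamp 0 (b - a) (t - s)) (g (clamp a b s)).

Lemma duhamel_integrand_eq (g : R -> E) (a b t s : R) :
  a <= s <= t -> t <= b -> duhamel_integrand g a b t s = S (t - s) (g s).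
Proof.
  intros hs ht. unfold duhamel_integrand.
  rewrite !clamp_id by lra. reflexivity.
Qed.

Lemma duhamel_integrand_continuous (g : R -> E) (a b t C : R) :
  a <= b -> 0 < C ->
  (forall tau, 0 <= tau <= b - a -> forall y, norm (S tau y) <= C * norm y) ->
  continuous_on (fun s => a <= s <= b) g ->
  forall s, continuous (duhamel_integrand g a b t) s.
Proof.
  intros hab hC hbd hg s. unfold duhamel_integrand.
  apply (semigroup_continuous S hS (fun r => clamp 0 (b - a) (t - r))
           (fun r => g (clamp a b r)) (b - a) C); trivial.
  - intros r. apply clamp_bounds. lra.
  - apply (continuous_comp (fun r => t - r) (clamp 0 (b - a))).
    + apply (continuous_minus (fun _ => t) (fun r => r)).
      * apply continuous_const.
      * apply continuous_id.
    + apply (continuous_clamp 0 (b - a) (fun r => r)); [lra|].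
      intros r _. apply filter_le_within.
  - now apply continuous_clamp.
Qed.

(** The operator [S (t - s)] can be moved inside the integral over [[a, s]]
    that enters [x s], where the semigroup law turns [S (s - r)] into
    [S (t - r)]; only the integral over [[s, t]] remains in the difference. *)
Lemma mild_solution_restart (f : R -> E -> E) (a b C : R) (x : R -> E) :
  0 < C ->
  (forall tau, 0 <= tau <= b - a -> forall y, norm (S tau y) <= C * norm y) ->
  continuous_on (fun s => a <= s <= b) (fun s => f s (x s)) ->
  mild_solution S f a b x ->
  forall s t, a <= s <= t -> t <= b ->
  is_RInt (duhamel_integrand (fun r => f r (x r)) a b t) s t
    (minus (x t) (S (t - s) (x s))).
Proof.
  intros hC hbd hg [_ hx] s t hs ht.
  set (g := fun r => f r (x r)) in *.
  set (phi := duhamel_integrand g a b).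
  assert (hint : forall t' u v, ex_RInt (phi t') u v).
  { intros t' u v. apply ex_RInt_continuous. intros z _.
    apply (duhamel_integrand_continuous g a b t' C); trivial. lra. }
  assert (hmild : forall t', a <= t' <= b ->
             x t' = plus (S (t' - a) (x a)) (RInt (phi t') a t')).
  { intros t' ht'. rewrite (hx t' ht'). f_equal.
    apply RInt_ext. intros r hr.
    rewrite Rmin_left, Rmax_right in hr by lra.
    symmetry. apply (duhamel_integrand_eq g); lra. }
  assert (hl : is_linear (S (t - s))) by (apply hS; lra).
  assert (hpast : RInt (phi t) a s = S (t - s) (RInt (phi s) a s)).
  { apply is_RInt_unique.
    apply is_RInt_ext with (fun r => S (t - s) (phi s r)).
    - intros r hr. rewrite Rmin_left, Rmax_right in hr by lra.
      unfold phi. rewrite !duhamel_integrand_eq by lra.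
      destruct hS as [_ [_ [hadd _]]].
      rewrite <- hadd by lra. f_equal. ring.
    - apply is_RInt_linear; [exact hl|]. apply RInt_correct, hint. }
  replace (minus (x t) (S (t - s) (x s))) with (RInt (phi t) s t).
  { apply RInt_correct, hint. }
  rewrite (hmild t), (hmild s) by lra.
  rewrite (linear_plus _ hl), <- hpast.
  destruct hS as [_ [_ [hadd _]]].
  rewrite <- hadd by lra.
  replace (t - s + (s - a)) with (t - a) by ring.
  rewrite <- (RInt_Chasles (phi t) a s t) by apply hint.
  rewrite plus_assoc. symmetry.
  exact (minus_plus_l (plus (S (t - a) (x a)) (RInt (phi t) a s))
           (RInt (phi t) s t)).
Qed.

(** The integrand in the restarted formula tends to [f t (x t)] as [s]
    approaches [t], so its integral over [[t + h, t]] is [- h f(t, x t)] up to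
    an error [o(|h|)]. *)
Lemma mild_solution_backward_expansion (f : R -> E -> E) (a b C : R) (x : R -> E) :
  0 < C ->
  (forall tau, 0 <= tau <= b - a -> forall y, norm (S tau y) <= C * norm y) ->
  continuous_on (fun s => a <= s <= b) (fun s => f s (x s)) ->
  mild_solution S f a b x ->
  forall t, a < t <= b -> forall eps, 0 < eps ->
  at_left 0 (fun h =>
    norm (minus (plus (x t) (scal h (f t (x t)))) (S (- h) (x (t + h))))
      <= - h * eps).
Proof.
  intros hC hbd hg hx t ht eps heps.
  set (g := fun r => f r (x r)) in *.
  assert (hphi : continuous (duhamel_integrand g a b t) t).
  { apply (duhamel_integrand_continuous g a b t C); trivial. lra. }
  assert (hphit : duhamel_integrand g a b t t = f t (x t)).
  { rewrite duhamel_integrand_eq by lra. rewrite Rminus_diag. apply hS. }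
  destruct (proj1 (filterlim_locally_ball_norm _ _) hphi (mkposreal eps heps))
    as [d hd].
  assert (hm : 0 < Rmin d (t - a)) by (apply Rmin_pos; [apply cond_pos|lra]).
  exists (mkposreal _ hm). intros h hh hneg.
  change (Rabs (h - 0) < Rmin d (t - a)) in hh.
  rewrite Rminus_0_r, Rabs_left in hh by exact hneg.
  assert (hhd := Rlt_le_trans _ _ _ hh (Rmin_l _ _)).
  assert (hha := Rlt_le_trans _ _ _ hh (Rmin_r _ _)).
  assert (hI := mild_solution_restart f a b C x hC hbd hg hx (t + h) t
                  ltac:(lra) ltac:(lra)).
  assert (hI' := is_RInt_minus _ _ _ _ _ _ hI
                   (is_RInt_const (t + h) t (f t (x t)))).
  replace (t - (t + h)) with (- h) in hI' by ring.
  replace (minus (plus (x t) (scal h (f t (x t)))) (S (- h) (x (t + h))))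
    with (minus (minus (x t) (S (- h) (x (t + h)))) (scal (- h) (f t (x t)))).
  2:{ exact (minus_minus_scal_opp (x t) (f t (x t)) (S (- h) (x (t + h))) h). }
  replace (- h * eps) with ((t - (t + h)) * eps) by ring.
  eapply norm_RInt_le_const; [lra| |exact hI'].
  intros r hr. left.
  rewrite <- hphit. apply hd.
  change (Rabs (r - t) < d).
  rewrite Rabs_left1; lra.
Qed.

End Mild.

(** * Closures and lower limits *)

Lemma closure_norm_bounded {E : NormedModule R_AbsRing} (K : E -> Prop) :
  norm_bounded K -> norm_bounded (closure K).
Proof.
  intros [M hM]. exists (M + 1). intros x hx.
  destruct (hx (ball_norm x (mkposreal 1 Rlt_0_1))) as [y [hy hKy]].
  - apply locally_le_locally_norm. now exists (mkposreal 1 Rlt_0_1).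
  - unfold ball_norm in hy; simpl in hy. rewrite norm_minus_sym in hy.
    specialize (hM y hKy).
    rewrite <- (plus_minus_r y x).
    eapply Rle_trans; [apply norm_triangle|]. lra.
Qed.

Lemma closure_cases {T : UniformSpace} (K : T -> Prop) (x : T) :
  closure K x -> K x \/ boundary K x.
Proof.
  intros hx. destruct (classic (K x)) as [h|h]; [now left|right].
  split; [exact hx|]. intros P hP. exists x. split; [|exact h].
  now apply locally_singleton.
Qed.

Lemma LimInf_filter_ge {T : Type} (F : (T -> Prop) -> Prop) (g : T -> R) (m : R) :
  F (fun u => m <= g u) -> Rbar_le (Finite m) (LimInf_filter F g).
Proof.
  intros hF. unfold LimInf_filter, Rbar_lub.
  destruct Rbar_ex_lub as [l hl]. change (Rbar_le m l).
  eapply Rbar_le_trans.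
  2:{ apply (proj1 hl). exists (fun u => m <= g u).
      split; [exact hF|reflexivity]. }
  apply Glb_Rbar_correct. intros y [u [hu ->]]. exact hu.
Qed.

Lemma LimInf_filter_nonneg {T : Type} (F : (T -> Prop) -> Prop) (g : T -> R) :
  (forall eps, 0 < eps -> F (fun u => - eps <= g u)) ->
  Rbar_le (Finite 0) (LimInf_filter F g).
Proof.
  intros H.
  assert (hge : forall eps, 0 < eps -> Rbar_le (Finite (- eps)) (LimInf_filter F g)).
  { intros eps he. apply LimInf_filter_ge, H, he. }
  destruct (LimInf_filter F g) as [l| |]; simpl in *; trivial.
  - apply Rnot_lt_le. intros hl. specialize (hge (- l / 2)). lra.
  - exact (hge 1 Rlt_0_1).
Qed.

(** The points [y h] follow the line [x + h v] to first order while [V] is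
    nonpositive on them.  The Lipschitz estimate transfers this sign to the
    line with an error [o(|h|)], and division by [h < 0] reverses it. *)
Lemma LimInf_quotient_nonneg {E : NormedModule R_AbsRing} (V : E -> R)
    (x v : E) (y : R -> E) :
  locally_Lipschitz V ->
  at_left 0 (fun h => V (y h) <= 0) ->
  (forall eps, 0 < eps -> at_left 0 (fun h =>
     norm (minus (plus x (scal h v)) (y h)) <= - h * eps)) ->
  Rbar_le (Finite 0)
    (LimInf_filter (at_left 0) (fun h => V (plus x (scal h v)) / h)).
Proof.
  intros hV hy hclose.
  destruct (hV x) as [L [U [hU hL]]].
  destruct (locally_norm_le_locally x U hU) as [r hr].
  apply LimInf_filter_nonneg. intros eps heps.
  assert (hLp := Rabs_pos L).
  assert (hLa := Rle_abs L).
  (* [L] may vanish or be negative, hence the denominator [|L| + 1]. *)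
  set (e := eps / (Rabs L + 1)).
  assert (he : 0 < e) by (apply Rdiv_lt_0_compat; lra).
  set (N := norm v). assert (hN : 0 <= N) by apply norm_ge_0.
  assert (hd : 0 < r / (N + e)).
  { apply Rdiv_lt_0_compat; [apply cond_pos|lra]. }
  (* For such [h], both [x + h v] and [y h] lie within [r] of [x]: the first is
     at distance at most [|h| N] and the second at most [|h| e] further. *)
  assert (hsmall : at_left 0 (fun h => h < 0 /\ - h * (N + e) < r)).
  { exists (mkposreal _ hd). intros h hh hneg. split; [exact hneg|].
    change (Rabs (h - 0) < r / (N + e)) in hh.
    rewrite Rminus_0_r, Rabs_left in hh by exact hneg.
    apply Rmult_lt_compat_r with (r := N + e) in hh; [|lra].
    replace (r / (N + e) * (N + e)) with (pos r) in hh by (field; lra).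
    exact hh. }
  generalize (filter_and _ _ hsmall (filter_and _ _ hy (hclose e he))).
  apply filter_imp. intros h [[hneg hh] [hVy hc]].
  set (w := plus x (scal h v)) in *.
  assert (hw : norm (minus w x) <= - h * N).
  { unfold w. rewrite minus_plus_l.
    eapply Rle_trans; [apply norm_scal_Rabs|].
    fold N. rewrite Rabs_left by exact hneg. lra. }
  assert (hUw : U w).
  { apply hr. unfold ball_norm. nra. }
  assert (hUy : U (y h)).
  { apply hr. unfold ball_norm.
    rewrite (minus_trans w). eapply Rle_lt_trans; [apply norm_triangle|].
    rewrite norm_minus_sym. lra. }
  assert (hVw : V w <= - h * eps).
  { assert (h1 := hL w (y h) hUw hUy).
    assert (h2 := Rle_abs (V w - V (y h))).
    assert (h3 := norm_ge_0 (minus w (y h))).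
    assert (h4 : eps = e * (Rabs L + 1)) by (unfold e; field; lra).
    rewrite h4.
    assert (h5 : L * norm (minus w (y h)) <= (Rabs L + 1) * (- h * e)) by nra.
    lra. }
  apply Rmult_le_reg_r with (- h); [lra|].
  replace (V w / h * - h) with (- V w) by (field; lra). lra.
Qed.

(** * Solutions stay off the boundary *)

Theorem theorem5p1 (E : CompleteNormedModule R_AbsRing) (a b : R) (hab : a < b)
  (DA : E -> Prop) (A : E -> E) (hA : linear_operator DA A)
  (S : R -> E -> E) (hS : C0_semigroup S) (hAS : generates DA A S)
  (f : R -> E -> E)
  (hf : continuous_on (fun p : R * E => a <= fst p <= b)
          (fun p : R * E => f (fst p) (snd p)))
  (K : E -> Prop) (hK0 : exists x, K x) (hKo : open K) (hKb : norm_bounded K)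
  (hV : exists V : E -> R, locally_Lipschitz V /\ bounding_function f a b K V)
  (hinv : exists delta : R, 0 < delta /\
     forall tau, 0 <= tau <= delta -> forall y, closure K y -> closure K (S tau y))
  (x : R -> E) (hx : mild_solution S f a b x)
  (hxK : forall t, a <= t <= b -> closure K (x t)) :
  forall t, a < t <= b -> K (x t).
Proof.
  destruct hV as [V [hVL [hV0 [hVK hV2]]]].
  destruct hinv as [delta [hdelta hinv]].
  assert (hVcl : forall y, closure K y -> V y <= 0).
  { intros y hy. destruct (closure_cases K y hy) as [h|h].
    - now apply hVK.
    - right. now apply hV0. }
  destruct (semigroup_bound_extend S hS delta hdelta
              (semigroup_bound_of_invariant S hS K delta hK0 hKo
                 (closure_norm_bounded K hKb) hinv) (b - a)) as [C [hC hbd]].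
  intros t ht.
  destruct (closure_cases K (x t)) as [h|hbdry]; [apply hxK; lra|exact h|].
  exfalso.
  apply (Rbar_lt_not_le _ _ (hV2 t (x t) ht hbdry)).
  apply LimInf_quotient_nonneg with (y := fun h => S (- h) (x (t + h)));
    [exact hVL| |].
  - assert (hm : 0 < Rmin delta (t - a)) by (apply Rmin_pos; lra).
    exists (mkposreal _ hm). intros h hh hneg.
    change (Rabs (h - 0) < Rmin delta (t - a)) in hh.
    rewrite Rminus_0_r, Rabs_left in hh by exact hneg.
    assert (hhd := Rlt_le_trans _ _ _ hh (Rmin_l _ _)).
    assert (hha := Rlt_le_trans _ _ _ hh (Rmin_r _ _)).
    apply hVcl, hinv; [lra|]. apply hxK. lra.
  - apply (mild_solution_backward_expansion S hS f a b C); trivial.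
    apply continuous_on_graph; [exact hf|]. apply hx.
Qed.
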